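(* Let $n$ be a positive integer and let $M\in\mathbb{R}^{n\times n}$ be a real symmetric matrix having exactly two distinct eigenvalues. Then $M$ has a nonnegative eigenvector, i.e. there exist a nonzero vector $x\in\mathbb{R}^n$ with $x_i\geq 0$ for all $i=1,\dots,n$ and a real number $\lambda$ such that $Mx=\lambda x$.
   Context: A vector $x\in\mathbb{R}^n$ is called nonnegative if all of its components (in the standard basis) are nonnegative. Eigenvectors are nonzero by definition. *)

(* Defs.v *)
From mathcomp Require Import all_boot all_order all_algebra.
From mathcomp Require Import reals.

Set Implicit Arguments.
Unset Strict Implicit.
Unset Printing Implicit Defensive.

Import GRing.Theory Num.Theory.
Local Open Scope ring_scope.

(* [eigenvalue M] is the library predicate, which is phrased with row vectors
   ([v *m M = c *: v]); transposing gives the column-vector notion for [M^T],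
   hence for [M] itself when [M] is symmetric. *)
Definition exactly_two_eigenvalues (R : realType) (n : nat) (M : 'M[R]_n) :
    Prop :=
  exists a b : R,
    a != b /\ forall c : R, eigenvalue M c <-> c = a \/ c = b.

(* Main.v *)
Require Import Defs.
From mathcomp Require Import all_boot all_order all_algebra.
From mathcomp Require Import ring lra.
From mathcomp Require Import complex.
From mathcomp Require Import reals classical_sets topology normedtype derive.

Import Order.TTheory GRing.Theory Num.Theory.
Import numFieldNormedType.Exports.
Local Open Scope ring_scope.

(** Let [a] and [b] be the two eigenvalues.  A real symmetric matrix is
    diagonalizable, so [(M - a)(M - b) = 0]
    ([symmetric_quadratic_annihilator]); hence [Q = (M - a) / (b - a)] is a
    symmetric idempotent, namely the orthogonal projection onto the
    [b]-eigenspace along the [a]-eigenspace.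

    It remains to see that, for an orthogonal projection [Q], either the kernel
    or the range contains a nonzero nonnegative vector.  Minimize the quadratic
    form of [Q] over the standard simplex, which is compact.  At a minimizer
    [x], moving towards a vertex does not decrease the form, and this
    first-order condition says that every coordinate of [Q x] is at least
    the minimum value ([simplex_qform_equilibrium]).  That value is the squared
    length of [Q x], so [Q x] is nonnegative.  If [Q x] is nonzero it is the
    required vector of the range; otherwise [x] itself lies in the kernel, and
    it is nonnegative and nonzero because it is a point of the simplex
    ([projection_nonneg_eigenvector]).

    Vectors are rows until the last step of the theorem, because the
    eigenvalue predicate and the compactness results are about rows. *)

Definition simplex (R : realType) (n : nat) : set 'rV[R]_n :=
  [set x | (forall i, 0 <= x 0 i) /\ \sum_i x 0 i = 1]%classic.

Lemma compact_simplex {R : realType} {n : nat} : compact (simplex R n).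
Proof.
pose box : set 'rV[R]_n := [set v | forall i, `[0, 1]%classic (v 0 i)]%classic.
apply: (@subclosed_compact _ _ box).
- have -> : simplex R n =
      ((\bigcap_(i in setT) (fun x : 'rV[R]_n => x 0 i) @^-1` [set t | 0 <= t]) `&`
       (fun x : 'rV[R]_n => \sum_i x 0 i)%R @^-1` [set t | t = 1])%classic.
    apply/seteqP; split=> x [x0 x1]; split=> // i; first by move=> _; exact: x0.
    exact: x0.
  apply: closedI; first apply: closed_bigI => i _.
    apply: (@preimage_closed _ _ (fun x : 'rV[R]_n => x 0 i)).
      by move=> x _; exact: coord_continuous.
    exact: closed_ge.
  apply: (@preimage_closed _ _ (fun x : 'rV[R]_n => \sum_i x 0 i)); last first.
    exact: closed_eq.
  move=> x _.
  apply: continuous_big; first exact: add_continuous.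
  by move=> i _; exact: coord_continuous.
- by apply: (@rV_compact R n (fun=> `[0, 1]%classic)) => i; exact: segment_compact.
- move=> x [x0 x1] i; rewrite /= in_itv /= x0 -x1 (bigD1 i) //= lerDl.
  by rewrite sumr_ge0.
Qed.

Definition qform {R : realType} {n : nat} (Q : 'M[R]_n) (x : 'rV[R]_n) : R :=
  (x *m Q *m x^T) 0 0.

Lemma qform_continuous {R : realType} {n : nat} (Q : 'M[R]_n) :
  continuous (qform Q).
Proof.
have -> : qform Q = fun x => \sum_j (\sum_i x 0 i * Q i j) * x 0 j.
  apply/boolp.funext => x; rewrite /qform mxE; apply: eq_bigr => j _.
  by rewrite !mxE.
apply: continuous_big; first exact: add_continuous.
move=> j _ x; apply: continuousM; last exact: coord_continuous.
apply: continuous_big; first exact: add_continuous.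
move=> i _ y; apply: continuousM; first exact: coord_continuous.
exact: cst_continuous.
Qed.

Lemma bilinear_sym {R : comPzRingType} {n : nat} (Q : 'M[R]_n) (x y : 'rV[R]_n) :
  Q^T = Q -> (x *m Q *m y^T) 0 0 = (y *m Q *m x^T) 0 0.
Proof.
move=> symQ; have -> : x *m Q *m y^T = (y *m Q *m x^T)^T.
  by rewrite !trmx_mul trmxK symQ mulmxA.
by rewrite mxE.
Qed.

Lemma qform_segment {R : realType} {n : nat} (Q : 'M[R]_n) (x d : 'rV[R]_n)
    (t : R) :
  Q^T = Q ->
  qform Q (x + t *: d) =
    qform Q x + t * (2 * (d *m Q *m x^T) 0 0 + t * qform Q d).
Proof.
move=> symQ; rewrite /qform; have := bilinear_sym Q x d symQ.
rewrite linearD linearZ /= !mulmxDl !mulmxDr -!scalemxAl -!scalemxAr.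
by rewrite !mxE => ->; ring.
Qed.

Lemma simplex_vertex {R : realType} {n : nat} (i : 'I_n) :
  simplex R n (delta_mx 0 i).
Proof.
split=> [j|]; first by rewrite mxE ler0n.
rewrite (bigD1 i) //= big1 ?addr0 => [|j /negPf ji]; first by rewrite mxE !eqxx.
by rewrite mxE ji andbF.
Qed.

Lemma simplex_segment {R : realType} {n : nat} (x y : 'rV[R]_n) (t : R) :
  0 <= t <= 1 -> simplex R n x -> simplex R n y ->
  simplex R n (x + t *: (y - x)).
Proof.
move=> /andP[t0 t1] [x0 x1] [y0 y1].
have coordE i : (x + t *: (y - x)) 0 i = (1 - t) * x 0 i + t * y 0 i.
  by rewrite !mxE; ring.
split=> [i|]; first by rewrite coordE addr_ge0 ?mulr_ge0 ?subr_ge0.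
under eq_bigr => i _ do rewrite coordE.
by rewrite big_split -!mulr_sumr /= x1 y1 !mulr1 subrK.
Qed.

(** First-order optimality at a minimizer [x] of the form over the simplex: the
    slope of the form from [x] towards the vertex [i] is twice
    [(x Q)_i - qform Q x], and it cannot be negative. *)
Lemma simplex_qform_equilibrium {R : realType} {n : nat} (Q : 'M[R]_n) :
  (0 < n)%N -> Q^T = Q ->
  exists2 x, simplex R n x & forall i, qform Q x <= (x *m Q) 0 i.
Proof.
move=> n_gt0 symQ.
have [] := @EVT_min_rV R n (qform Q) (simplex R n).
- by exists (delta_mx 0 (Ordinal n_gt0)); exact: simplex_vertex.
- exact: compact_simplex.
- by apply: continuous_subspaceT; exact: qform_continuous.
move=> x /set_mem Sx minx; exists x => // i; rewrite leNgt; apply/negP => lt_i.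
pose d := delta_mx 0 i - x.
have slope : (d *m Q *m x^T) 0 0 = (x *m Q) 0 i - qform Q x.
  rewrite !mulmxBl mxE [X in _ + X]mxE /qform; congr (_ - _).
  by rewrite bilinear_sym // trmx_delta -colE mxE.
(* This [t] keeps the quadratic term [t * qform Q d] below the linear gain [2 s]. *)
pose s := qform Q x - (x *m Q) 0 i.
have s_gt0 : 0 < s by rewrite subr_gt0.
have den_gt0 : 0 < s + `|qform Q d| by rewrite ltr_wpDr.
pose t := s / (s + `|qform Q d|).
have t_gt0 : 0 < t by rewrite divr_gt0.
have t_le1 : t <= 1 by rewrite ler_pdivrMr // mul1r lerDl.
have St : simplex R n (x + t *: d).
  by apply: simplex_segment (simplex_vertex _) => //; rewrite ltW.
have := minx _ (mem_set St).
rewrite qform_segment // lerDl pmulr_rge0 // slope; apply/negP; rewrite -ltNge.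
have tq_le : t * qform Q d <= t * `|qform Q d| by rewrite ler_pM2l // ler_norm.
have t_den : t * s + t * `|qform Q d| = s by rewrite -mulrDr divfK // gt_eqF.
have ts_gt0 : 0 < t * s by rewrite mulr_gt0.
have -> : (x *m Q) 0 i - qform Q x = - s by rewrite opprB.
lra.
Qed.

(** By the spectral theorem over [R[i]], [M] is unitarily similar to a real
    diagonal matrix, whose entries are eigenvalues of [M]; the quadratic then
    kills each diagonal entry. *)
Lemma symmetric_quadratic_annihilator {R : rcfType} {n : nat} (M : 'M[R]_n)
    (a b : R) :
  M^T = M -> (forall c, eigenvalue M c -> c = a \/ c = b) ->
  (M - a%:M) *m (M - b%:M) = 0.
Proof.
move=> symM eigM.
pose toC : {rmorphism R -> R[i]} := real_complex R.
pose A : 'M[R[i]]_n := map_mx toC M.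
have hermA : A \is hermsymmx.
  apply: realsym_hermsym.
    by apply/is_hermitianmxP; rewrite expr0 scale1r map_mx_id // /A map_trmx symM.
  by apply/mxOverP => i j; rewrite mxE; apply/complex_realP; exists (M i j).
have realD := hermitian_spectral_diag_real hermA.
have /orthomx_spectralP := hermitian_normalmx hermA.
have := spectral_unit A; set P := spectralmx A; set d := spectral_diag A.
move=> unitP AE.
have PA : P *m A = diag_mx d *m P by rewrite AE !mulmxA mulmxV // mul1mx.
have dE i : d 0 i = toC a \/ d 0 i = toC b.
  have /complex_realP[c dc] : d 0 i \is Num.real by apply/mxOverP.
  rewrite dc; suff /eigM[->|->] : eigenvalue M c by [left|right].
  (* The eigenvector for [d 0 i] is row [i] of the invertible matrix [P]. *)
  rewrite -(eigenvalue_map toC); apply/eigenvalueP; exists (row i P).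
    by rewrite -row_mul PA; apply/rowP => j; rewrite mul_diag_mx !mxE dc.
  apply: contraTneq unitP => Pi0; rewrite -row_free_unit.
  apply/negP => /row_freeP[B PB]; have := congr1 (row i) PB.
  rewrite row_mul Pi0 mul0mx => /rowP/(_ i)/eqP; rewrite !mxE eqxx.
  by rewrite eq_sym oner_eq0.
apply: (@map_mx_inj _ _ toC); rewrite map_mxM !map_mxB !map_scalar_mx map_mx0 -/A.
have shift c : P *m (A - c%:M) = (diag_mx d - c%:M) *m P.
  by rewrite mulmxBr mulmxBl PA scalar_mxC.
rewrite -[LHS](mulKmx unitP) [P *m _]mulmxA shift.
rewrite -[_ *m P *m _]mulmxA shift [X in invmx P *m X]mulmxA.
suff -> : (diag_mx d - (toC a)%:M) *m (diag_mx d - (toC b)%:M) = 0.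
  by rewrite mul0mx mulmx0.
rewrite -!diag_const_mx -!raddfB mulmx_diag; apply/matrixP => i j.
by rewrite !mxE; case: (dE i) => ->; rewrite subrr ?mul0r ?mulr0 mul0rn.
Qed.

(** The minimum value in [simplex_qform_equilibrium] is the squared length of
    [x Q], so [x Q] is nonnegative: it serves unless it vanishes, and then [x]
    serves. *)
Lemma projection_nonneg_eigenvector {R : realType} {n : nat} (Q : 'M[R]_n) :
  (0 < n)%N -> Q^T = Q -> Q *m Q = Q ->
  exists x : 'rV[R]_n,
    [/\ x != 0, forall i, 0 <= x 0 i & x *m Q = 0 \/ x *m Q = x].
Proof.
move=> n_gt0 symQ idemQ.
have [x [x_ge0 x_sum1] eqx] := simplex_qform_equilibrium Q n_gt0 symQ.
have q_ge0 : 0 <= qform Q x.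
  have -> : qform Q x = \sum_i (x *m Q) 0 i ^+ 2.
    have -> : qform Q x = ((x *m Q) *m (x *m Q)^T) 0 0.
      by rewrite trmx_mul symQ -mulmxA [Q *m _]mulmxA idemQ mulmxA.
    by rewrite mxE; apply: eq_bigr => i _; rewrite [X in _ * X]mxE expr2.
  by apply: sumr_ge0 => i _; exact: sqr_ge0.
have [xQ0|xQ_neq0] := eqVneq (x *m Q) 0; last first.
  exists (x *m Q); split=> // [i|]; first exact: le_trans (eqx i).
  by right; rewrite -mulmxA idemQ.
exists x; split=> //; last by left.
apply/eqP => x0; move: x_sum1; rewrite x0 big1 => [/eqP|i _]; last by rewrite mxE.
by rewrite eq_sym oner_eq0.
Qed.

Theorem mainTheorem1 (R : realType) (n : nat) (hn : (0 < n)%N)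
    (M : 'M[R]_n) (symM : M^T = M) (hM : exactly_two_eigenvalues M) :
  exists (x : 'cV[R]_n) (lambda : R),
    [/\ x != 0, (forall i : 'I_n, 0 <= x i 0) & M *m x = lambda *: x].
Proof.
have [a [b [a_neq_b eigM]]] := hM.
have ba_neq0 : b - a != 0 by rewrite subr_eq0 eq_sym.
have annM := symmetric_quadratic_annihilator M a b symM
  (fun c => proj1 (eigM c)).
pose Q := (b - a)^-1 *: (M - a%:M).
have ME : M = a%:M + (b - a) *: Q.
  by rewrite scalerA divff // scale1r addrC subrK.
have symQ : Q^T = Q by rewrite linearZ linearB /= symM tr_scalar_mx.
have idemQ : Q *m Q = Q.
  apply/eqP; rewrite -subr_eq0 -[X in _ - X]mulmx1 -mulmxBr.
  have -> : Q - 1%:M = (b - a)^-1 *: (M - b%:M).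
    apply: (scalerI ba_neq0); rewrite scalerBr !scalerA divff // !scale1r.
    by rewrite scalemx1 raddfB /= opprB addrA subrK.
  by rewrite -scalemxAl -scalemxAr annM !scaler0.
have [x [x_neq0 x_ge0 xQ]] := projection_nonneg_eigenvector Q hn symQ idemQ.
have [c xM] : exists c, x *m M = c *: x.
  case: xQ => xQ; [exists a|exists b];
    rewrite ME mulmxDr -scalemxAr xQ mul_mx_scalar ?scaler0 ?addr0 //.
  by rewrite -scalerDl addrC subrK.
exists x^T, c; split; first by rewrite trmx_eq0.
  by move=> i; rewrite mxE.
by rewrite -[in LHS]symM -trmx_mul xM linearZ.
Qed.
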